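(* Let $1 \le p \le 2$ with Hölder conjugate $q$, let $n \ge 2$, $0<\epsilon<1$ and $0<\delta<1/2$. Consider the collision tester: draw $m$ i.i.d. samples from the unknown distribution $A$ on $\{1,\dots,n\}$, let $C=\sum_{1\le j<k\le m}\mathbf{1}[\text{$j$th sample}=\text{$k$th sample}]$ be the number of collisions, let $T=\binom{m}{2}\frac1n+\sqrt{\frac1\delta\binom m2\frac1n}$, and output ``uniform'' if $C\le T$ and ``not uniform'' if $C>T$. If the number of samples is \[ m=\frac{9}{\delta}\begin{cases}\dfrac{\sqrt n}{(\epsilon n^{1/q})^2} & n\le \frac{1}{\epsilon^q},\\[1em] \dfrac12\sqrt{\left(\frac{2}{\epsilon}\right)^q} & n\ge \frac1{\epsilon^q},\end{cases}\] then this tester solves the uniformity testing problem for $\ell_p$ distance with tolerance $\epsilon$ and failure probability $\delta$: if $A=U_n$ it outputs ``uniform'' with probability at least $1-\delta$, and if $\|A-U_n\|_p\ge\epsilon$ it outputs ``not uniform'' with probability at least $1-\delta$.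
   Context: A distribution on support size $n$ is a vector $A\in\mathbb{R}^n$ with $A_i\ge0$, $\sum_iA_i=1$ ($A_i$ the probability of drawing $i$); $U_n=(1/n,\dots,1/n)$. For $p\ge1$, $\|V\|_p=(\sum_i|V_i|^p)^{1/p}$ and $\|V\|_\infty=\max_i|V_i|$. The Hölder conjugate $q$ of $p$ is $q=p/(p-1)$ for $1<p<\infty$, $q=\infty$ for $p=1$, $q=1$ for $p=\infty$. Conventions: when $q=\infty$, $n^{1/q}=1$ and $1/\epsilon^q=\infty$ (so, as $0<\epsilon<1$, $n\le 1/\epsilon^q$ holds for every $n$). *)

(* Defs.v *)
From mathcomp Require Import all_boot all_order all_algebra.
From mathcomp Require Import boolp classical_sets reals ereal exp hoelder.

Set Implicit Arguments.
Unset Strict Implicit.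
Unset Printing Implicit Defensive.

Import Order.TTheory GRing.Theory Num.Theory.
Local Open Scope ring_scope.

(* The support {1, ..., n} is represented by 'I_n. *)
Definition is_distribution (R : realType) (n : nat) (A : 'rV[R]_n) : Prop :=
  (forall i, 0 <= A 0 i) /\ \sum_(i < n) A 0 i = 1.

Definition uniform_dist (R : realType) (n : nat) : 'rV[R]_n :=
  const_mx n%:R^-1.

Definition lp_norm (R : realType) (n : nat) (p : R) (V : 'rV[R]_n) : R :=
  (\sum_(i < n) `|V 0 i| `^ p) `^ p^-1.

(* Probability of the event E when s 0, ..., s (m - 1) are i.i.d. draws
   from A, i.e. under the product distribution A^m on the sample space. *)
Definition iid_prob (R : realType) (n m : nat) (A : 'rV[R]_n)
    (E : pred {ffun 'I_m -> 'I_n}) : R :=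
  \sum_(s : {ffun 'I_m -> 'I_n} | E s) \prod_(j < m) A 0 (s j).

Inductive verdict := Uniform | NotUniform.

Definition is_Uniform (v : verdict) : bool :=
  if v is Uniform then true else false.

Definition is_NotUniform (v : verdict) : bool :=
  if v is NotUniform then true else false.

Definition solves_uniformity_testing (R : realType) (n m : nat)
    (p eps delta : R) (tester : {ffun 'I_m -> 'I_n} -> verdict) : Prop :=
  1 - delta <= iid_prob (uniform_dist R n) (fun s => is_Uniform (tester s))
  /\ forall A : 'rV[R]_n, is_distribution A ->
       eps <= lp_norm p (A - uniform_dist R n) ->
       1 - delta <= iid_prob A (fun s => is_NotUniform (tester s)).

Definition collisions (n m : nat) (s : {ffun 'I_m -> 'I_n}) : nat :=
  (\sum_(j < m) \sum_(k < m | j < k) (s j == s k))%N.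

Definition collision_threshold (R : realType) (n m : nat) (delta : R) : R :=
  'C(m, 2)%:R * (1 / n%:R)
  + Num.sqrt (1 / delta * 'C(m, 2)%:R * (1 / n%:R)).

Definition collision_tester (R : realType) (n m : nat) (delta : R)
    (s : {ffun 'I_m -> 'I_n}) : verdict :=
  if (collisions s)%:R <= collision_threshold n m delta
  then Uniform else NotUniform.

(* n ^ (1 / q) for q in [1, +oo]; as +oo^-1 = 0 in \bar R, it is 1 at q = +oo. *)
Definition root_pow (R : realType) (n : nat) (q : \bar R) : R :=
  n%:R `^ fine (q^-1)%E.

(* 1 / eps ^ q for q in [1, +oo] and 0 < eps < 1; the value at q = -oo is
   irrelevant. *)
Definition inv_eps_pow (R : realType) (eps : R) (q : \bar R) : \bar R :=
  if q is r%:E%E then (1 / eps `^ r)%:E%E else +oo%E.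

Definition samples_small (R : realType) (n : nat) (q : \bar R)
    (eps delta : R) : R :=
  9 / delta * (Num.sqrt n%:R / (eps * root_pow n q) ^+ 2).

(* Only used for finite q: the case q = +oo never satisfies n >= 1 / eps ^ q. *)
Definition samples_large (R : realType) (q : \bar R) (eps delta : R) : R :=
  9 / delta * (1 / 2 * Num.sqrt ((2 / eps) `^ fine q)).

(* The prescribed number of samples, rounded up to an integer. The two cases
   overlap at n = 1 / eps ^ q, where the formulas may differ; either value is
   then allowed. *)
Definition prescribed_samples (R : realType) (n : nat) (q : \bar R)
    (eps delta : R) (m : nat) : Prop :=
  ((n%:R%:E <= inv_eps_pow eps q)%E
     /\ m%:Z = Num.ceil (samples_small n q eps delta))
  \/ ((inv_eps_pow eps q <= n%:R%:E)%E
     /\ m%:Z = Num.ceil (samples_large q eps delta)).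

(* Main.v *)
(** Write [nu = 1 / n], [V = A - U_n], [alpha = sum V_i ^ 2], [N = 'C(m, 2)],
    [b = sum A_i ^ 2] and [c = sum A_i ^ 3].  The number of collisions has mean
    [N b = N (nu + alpha)].  Its Hoeffding decomposition splits
    [[x = y] - b] into [h x + h y + g x y] with [h x = A_x - b], all terms being
    pairwise orthogonal, so its variance is
    [N (2 (m - 1) (c - b ^ 2) + b - 2 c + b ^ 2)].  For [A = U_n] one has
    [c = b ^ 2], and Chebyshev's inequality gives completeness.
    For soundness, [c - b ^ 2 <= nu alpha + alpha ^ (3 / 2) - alpha ^ 2] and
    Chebyshev's inequality suffices as soon as
    [9 sqrt nu <= m delta alpha] and [9 <= m delta sqrt alpha].
    Both follow from the sample size, using
    [(eps n ^ (1 / q)) ^ 2 <= n alpha] (power means) and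
    [4 (eps / 2) ^ q <= alpha] (interpolation of l_p between l_1 and l_2, as
    [||V||_1 <= 2]). *)

Require Import Defs.
From mathcomp Require Import all_boot all_order all_algebra.
From mathcomp Require Import boolp classical_sets reals ereal exp hoelder.
From mathcomp Require Import ring lra zify.

Set Implicit Arguments.
Unset Strict Implicit.
Unset Printing Implicit Defensive.

Import Order.TTheory GRing.Theory Num.Theory.
Local Open Scope ring_scope.

(** * Expectation under the product distribution and integrating out one coordinate *)

Definition iid_mean (R : realType) (n m : nat) (A : 'rV[R]_n)
    (X : {ffun 'I_m -> 'I_n} -> R) : R :=
  \sum_(s : {ffun 'I_m -> 'I_n}) (\prod_(j < m) A 0 (s j)) * X s.

Definition resample (n m : nat) (s : {ffun 'I_m -> 'I_n}) (i : 'I_m)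
    (x : 'I_n) : {ffun 'I_m -> 'I_n} :=
  [ffun j => if j == i then x else s j].

Section IidMean.
Context (R : realType) (n m : nat) (A : 'rV[R]_n) (hA : \sum_i A 0 i = 1).
Implicit Types (s : {ffun 'I_m -> 'I_n}) (X Y : {ffun 'I_m -> 'I_n} -> R).

Lemma resample_id s i x : resample s i x i = x.
Proof. by rewrite ffunE eqxx. Qed.

Lemma resample_neq s i x j : j != i -> resample s i x j = s j.
Proof. by rewrite ffunE => /negbTE ->. Qed.

Lemma iid_meanD X Y :
  iid_mean A (fun s => X s + Y s) = iid_mean A X + iid_mean A Y.
Proof. by rewrite -big_split; apply: eq_bigr => s _; rewrite mulrDr. Qed.

Lemma iid_meanZ a X : iid_mean A (fun s => a * X s) = a * iid_mean A X.
Proof.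
by rewrite /iid_mean mulr_sumr; apply: eq_bigr => s _; rewrite mulrCA.
Qed.

Lemma iid_mean_sum (I : Type) (r : seq I) (P : pred I)
    (F : I -> {ffun 'I_m -> 'I_n} -> R) :
  iid_mean A (fun s => \sum_(k <- r | P k) F k s)
  = \sum_(k <- r | P k) iid_mean A (F k).
Proof. by rewrite exchange_big; apply: eq_bigr => s _; rewrite mulr_sumr. Qed.

Lemma eq_iid_mean X Y : X =1 Y -> iid_mean A X = iid_mean A Y.
Proof. by move=> XY; apply: eq_bigr => s _; rewrite XY. Qed.

Lemma sum_iid_weight : \sum_(s : {ffun 'I_m -> 'I_n}) \prod_j A 0 (s j) = 1.
Proof. by rewrite -(bigA_distr_bigA (fun _ => A 0)) /= big1. Qed.

Lemma iid_mean_cst a : iid_mean A (fun _ : {ffun 'I_m -> 'I_n} => a) = a.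
Proof. by rewrite /iid_mean -mulr_suml sum_iid_weight mul1r. Qed.

(* [(s, x) |-> (resample s i x, s i)] is a weight-preserving involution. *)
Lemma iid_mean_resample i X :
  iid_mean A X = iid_mean A (fun s => \sum_x A 0 x * X (resample s i x)).
Proof.
rewrite /iid_mean; under [RHS]eq_bigr do rewrite mulr_sumr.
rewrite pair_bigA /=.
pose h (u : {ffun 'I_m -> 'I_n} * 'I_n) := (resample u.1 i u.2, u.1 i).
have hh : involutive h.
  case=> s x; congr pair; last by rewrite resample_id.
  apply/ffunP => j; rewrite ffunE /=.
  by case: eqP => [->//|/eqP ji]; rewrite resample_neq.
rewrite (reindex_inj (inv_inj hh)) /=.
under [RHS]eq_bigr => u _.
  have -> : resample (resample u.1 i u.2) i (u.1 i) = u.1.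
    by have /(congr1 fst) := hh u.
  rewrite mulrA [_ * A 0 _](_ : _ = (\prod_j A 0 (u.1 j)) * A 0 u.2).
    over.
  rewrite (bigD1 i) //= [in RHS](bigD1 i) //= resample_id.
  rewrite (eq_bigr (fun j => A 0 (u.1 j))) => [|j ji]; first ring.
  by rewrite resample_neq.
rewrite -(pair_bigA _ (fun s x => (\prod_j A 0 (s j)) * A 0 x * X s)) /=.
apply: eq_bigr => s _; rewrite -mulr_suml -mulr_sumr hA mulr1 //.
Qed.

(** The inner sum is the conditional mean given all draws but the [i]th. Every orthogonality
    relation below is obtained by choosing a coordinate for which it vanishes. *)
Lemma iid_mean_eq0 i X :
  (forall s, \sum_x A 0 x * X (resample s i x) = 0) -> iid_mean A X = 0.
Proof.
move=> X0; rewrite (iid_mean_resample i) (eq_iid_mean X0).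
exact: iid_mean_cst.
Qed.


Lemma iid_mean_sqr_sum (I : finType) (P : pred I)
    (F : I -> {ffun 'I_m -> 'I_n} -> R) :
  (forall e e', P e -> P e' -> e != e' ->
     iid_mean A (fun s => F e s * F e' s) = 0) ->
  iid_mean A (fun s => (\sum_(e | P e) F e s) ^+ 2)
  = \sum_(e | P e) iid_mean A (fun s => F e s ^+ 2).
Proof.
move=> FF0.
rewrite (@eq_iid_mean _
  (fun s => \sum_(e | P e) \sum_(e' | P e') F e s * F e' s)).
  rewrite iid_mean_sum; apply: eq_bigr => e Pe.
  rewrite iid_mean_sum (bigD1 e) //= big1 ?addr0 // => e' /andP[Pe' ee'].
  by apply: FF0 => //; rewrite eq_sym.
by move=> s; rewrite expr2 mulr_suml; apply: eq_bigr => e _; rewrite mulr_sumr.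
Qed.

End IidMean.

(** * Sums over pairs of sample indices *)

(** Each index lies in exactly [m - 1] pairs, as smaller or as larger element. *)
Lemma sum_lt_ord_sym (R : pzRingType) (m : nat) (u : 'I_m -> R) :
  \sum_(e : 'I_m * 'I_m | (e.1 < e.2)%N) (u e.1 + u e.2)
  = m.-1%:R * \sum_j u j.
Proof.
rewrite -(pair_big_dep xpredT (fun j k : 'I_m => (j < k)%N)
  (fun j k => u j + u k)) /=.
under eq_bigr do rewrite big_split /=.
rewrite big_split /= [X in _ + X](exchange_big_dep xpredT) //=.
rewrite -big_split mulr_sumr /=.
rewrite [LHS](eq_bigr (fun j => \sum_(k < m | k != j) u j)) => [|j _].
  apply: eq_bigr => j _; rewrite sumr_const -[LHS]mulr_natl; congr (_%:R * _).
  by rewrite cardC1 card_ord.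
rewrite [RHS](bigID (fun k : 'I_m => (k < j)%N)) /= addrC; congr (_ + _);
  by apply: eq_bigl => k; rewrite -val_eqE /=; case: ltngtP.
Qed.

Lemma sum_lt_ord1 (R : numDomainType) (m : nat) :
  \sum_(e : 'I_m * 'I_m | (e.1 < e.2)%N) 1 = 'C(m, 2)%:R :> R.
Proof.
apply: (@mulfI _ 2%:R); first by rewrite pnatr_eq0.
rewrite -natrM -[(2 * _)%N](mul_bin_diag m 1) bin1 natrM mulr_sumr.
have sum1 : \sum_(j < m) 1 = m%:R :> R by rewrite sumr_const card_ord.
have /= := @sum_lt_ord_sym R m (fun=> 1); rewrite sum1 mulrC => <-.
by apply: eq_bigr => e _; rewrite mulr1.
Qed.

(** * Variance of the collision count by Hoeffding decomposition *)

Section CollisionVariance.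
Context (R : realType) (n m : nat) (A : 'rV[R]_n) (hA : \sum_i A 0 i = 1).
Let b := \sum_i A 0 i ^+ 2.
Let c := \sum_i A 0 i ^+ 3.
Let h x := A 0 x - b.
Let g x y := (x == y)%:R - A 0 x - A 0 y + b.
Let L (s : {ffun 'I_m -> 'I_n}) := \sum_j h (s j).
Let G (s : {ffun 'I_m -> 'I_n}) :=
  \sum_(e : 'I_m * 'I_m | (e.1 < e.2)%N) g (s e.1) (s e.2).

Lemma collisions_centered s :
  (collisions s)%:R - 'C(m, 2)%:R * b = m.-1%:R * L s + G s.
Proof.
rewrite /collisions (pair_big_dep xpredT (fun j k : 'I_m => (j < k)%N)) /=.
rewrite natr_sum -sum_lt_ord1 mulr_suml -sumrB -sum_lt_ord_sym -big_split /=.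
by apply: eq_bigr => e _; rewrite /h /g; ring.
Qed.

Lemma sum_hoeffding1 : \sum_x A 0 x * h x = 0.
Proof.
under eq_bigr do rewrite mulrBr.
by rewrite sumrB -mulr_suml hA mul1r -(eq_bigr _ (fun i _ => expr2 _)) subrr.
Qed.

Lemma sum_indicator (F : 'I_n -> R) x : \sum_y F y * (x == y)%:R = F x.
Proof.
rewrite (bigD1 x) //= eqxx mulr1 big1 ?addr0 // => y.
by rewrite eq_sym => /negbTE ->; rewrite mulr0.
Qed.

(** Degeneracy of the kernel: the mean of [(x == y)] over [y] is [A 0 x], which is exactly what [g]
    subtracts. *)
Lemma sum_hoeffding2 x : \sum_y A 0 y * g x y = 0.
Proof.
rewrite (eq_bigr (fun y => A 0 y * (x == y)%:R - A 0 y * h y - A 0 y * A 0 x)).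
  by rewrite !sumrB sum_indicator sum_hoeffding1 -mulr_suml hA; ring.
by move=> y _; rewrite /g /h; ring.
Qed.

Lemma sum_hoeffding2_sqr :
  \sum_y A 0 y * (\sum_x A 0 x * g x y ^+ 2) = b - 2 * c + b ^+ 2.
Proof.
rewrite (eq_bigr (fun y =>
  A 0 y ^+ 2 * (1 + 2 * b) - A 0 y ^+ 3 * 3 + A 0 y * (c - b ^+ 2))).
  by rewrite big_split sumrB /= -!mulr_suml hA -/b -/c; ring.
(* The indicator is idempotent, so the square of [g] is linear in it; the rest is expanded in powers
   of [A 0 x]. *)
move=> y _; rewrite (eq_bigr (fun x =>
    A 0 x * (1 + 2 * (b - A 0 x - A 0 y)) * (y == x)%:R
    + A 0 x ^+ 3 - 2 * (b - A 0 y) * A 0 x ^+ 2 + (b - A 0 y) ^+ 2 * A 0 x)).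
  rewrite !big_split /= sum_indicator sumrN -!mulr_sumr hA -/b -/c; ring.
by move=> x _; rewrite /g eq_sym; case: (y == x) => /=; ring.
Qed.

Lemma hoeffding2_sym x y : g x y = g y x.
Proof. by rewrite /g eq_sym; ring. Qed.

Lemma mean_linear_sqr : iid_mean A (fun s => L s ^+ 2) = m%:R * (c - b ^+ 2).
Proof.
rewrite /L iid_mean_sqr_sum => [|i j _ _ ij].
  rewrite -[in RHS](card_ord m) mulr_natl -sumr_const; apply: eq_bigr => j _.
  rewrite (iid_mean_resample hA j).
  rewrite (@eq_iid_mean _ _ _ _ _ (fun=> c - b ^+ 2)) ?iid_mean_cst // => s.
  under eq_bigr do rewrite resample_id.
  rewrite (eq_bigr (fun x => A 0 x ^+ 3 - A 0 x ^+ 2 * b - b * (A 0 x * h x))).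
    by rewrite !sumrB -mulr_suml -mulr_sumr sum_hoeffding1 -/b -/c; ring.
  by move=> x _; rewrite /h; ring.
apply: (iid_mean_eq0 hA (i := i)) => s.
under eq_bigr do rewrite resample_id resample_neq 1?eq_sym // mulrA.
by rewrite -mulr_suml sum_hoeffding1 mul0r.
Qed.

(** If [Y] ignores one endpoint of [e], averaging over that endpoint alone kills [g] by
    degeneracy. *)
Lemma mean_hoeffding2_eq0 (e : 'I_m * 'I_m) Y : (e.1 < e.2)%N ->
  (exists2 i, i = e.1 \/ i = e.2 & forall s x, Y (resample s i x) = Y s) ->
  iid_mean A (fun s => g (s e.1) (s e.2) * Y s) = 0.
Proof.
move=> lte [i ie Yi].
have e12 : e.1 != e.2 by rewrite -val_eqE /= ltn_eqF.
apply: (iid_mean_eq0 hA (i := i)) => s.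
case: ie => ie; rewrite {}ie in Yi *.
  under eq_bigr do rewrite resample_id resample_neq 1?eq_sym // Yi
    hoeffding2_sym mulrA.
  by rewrite -mulr_suml sum_hoeffding2 mul0r.
under eq_bigr do rewrite resample_id resample_neq // Yi mulrA.
by rewrite -mulr_suml sum_hoeffding2 mul0r.
Qed.

Lemma mean_linear_quadratic : iid_mean A (fun s => L s * G s) = 0.
Proof.
rewrite (@eq_iid_mean _ _ _ _ _ (fun s => \sum_(e : 'I_m * 'I_m | (e.1 < e.2)%N)
  \sum_j g (s e.1) (s e.2) * h (s j))) => [|s].
  rewrite iid_mean_sum big1 // => e lte; rewrite iid_mean_sum big1 // => j _.
  apply: mean_hoeffding2_eq0 => //.
  (* The index [j] misses at least one endpoint of [e]; that endpoint is the coordinate to integrate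
     out. *)
  have [je|je] := eqVneq j e.1; last first.
    by exists e.1 => [|s x]; [left|rewrite resample_neq].
  exists e.2 => [|s x]; [by right|rewrite resample_neq //].
  by rewrite je -val_eqE /= ltn_eqF.
by rewrite mulrC mulr_suml; apply: eq_bigr => e _; rewrite mulr_sumr.
Qed.

Lemma mean_quadratic_sqr :
  iid_mean A (fun s => G s ^+ 2) = 'C(m, 2)%:R * (b - 2 * c + b ^+ 2).
Proof.
rewrite /G iid_mean_sqr_sum => [|[i j] [k l] /= ij kl ne].
  rewrite -sum_lt_ord1 mulr_suml; apply: eq_bigr => -[i j] /= ij.
  rewrite mul1r (iid_mean_resample hA i) (iid_mean_resample hA j).
  rewrite (@eq_iid_mean _ _ _ _ _ (fun=> b - 2 * c + b ^+ 2)) ?iid_mean_cst // => s.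
  have nij : i != j by rewrite -val_eqE /= ltn_eqF.
  under eq_bigr => y _.
    under eq_bigr => x _.
      rewrite resample_id resample_neq 1?eq_sym // resample_id.
      over.
    over.
  exact: sum_hoeffding2_sqr.
apply: (@mean_hoeffding2_eq0 (i, j)) => //=.
(* Two distinct increasing pairs share at most one index: if [i] is in the second pair, [j] is
   not. *)
have [iE|iN] := boolP ((i == k) || (i == l)); last first.
  move: iN; rewrite negb_or => /andP[ik il].
  by exists i => [|s x]; [left|rewrite !resample_neq // eq_sym].
exists j => [|s x]; first by right.
rewrite !resample_neq //; rewrite -?val_eqE /=; move: ne iE ij kl.
  by rewrite xpair_eqE -!val_eqE /=; lia.
by rewrite xpair_eqE -!val_eqE /=; lia.
Qed.

Lemma collision_variance :
  iid_mean A (fun s : {ffun 'I_m -> 'I_n} =>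
    ((collisions s)%:R - 'C(m, 2)%:R * b) ^+ 2)
  = 'C(m, 2)%:R * (2 * m.-1%:R * (c - b ^+ 2) + (b - 2 * c + b ^+ 2)).
Proof.
rewrite (@eq_iid_mean _ _ _ _ _ (fun s => m.-1%:R ^+ 2 * L s ^+ 2
  + (2 * m.-1%:R * (L s * G s) + G s ^+ 2))) => [|s]; last first.
  by rewrite collisions_centered; ring.
rewrite !iid_meanD !iid_meanZ.
rewrite mean_linear_sqr mean_linear_quadratic mean_quadratic_sqr.
have : (m%:R * m.-1%:R)%R = 2 * 'C(m, 2)%:R :> R.
  by rewrite -!natrM -(mul_bin_diag m 1) bin1.
set N := 'C(m, 2)%:R; set u := m.-1%:R; set v := c - b ^+ 2 => mu.
have -> : u ^+ 2 * (m%:R * v) = u * (m%:R * u) * v by ring.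
by rewrite mu; ring.
Qed.

End CollisionVariance.

(** * Chebyshev's inequality and the numerical estimate behind soundness *)

Lemma iid_prob_chebyshev (R : realType) (n m : nat) (A : 'rV[R]_n)
    (E : pred {ffun 'I_m -> 'I_n}) (X : {ffun 'I_m -> 'I_n} -> R)
    (mu gap delta : R) :
  is_distribution A -> 0 < gap ->
  (forall s, ~~ E s -> gap ^+ 2 <= (X s - mu) ^+ 2) ->
  iid_mean A (fun s => (X s - mu) ^+ 2) <= delta * gap ^+ 2 ->
  1 - delta <= iid_prob A E.
Proof.
move=> [A0 A1] gap0 hE hX.
have w0 (s : {ffun 'I_m -> 'I_n}) : 0 <= \prod_j A 0 (s j).
  by apply: prodr_ge0 => j _.
have <- : iid_prob A E + iid_prob A (predC E) = 1.
  by rewrite -(sum_iid_weight m A1) [RHS](bigID E).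
rewrite lerBlDr lerD2l -(@ler_pM2r _ (gap ^+ 2)) ?exprn_gt0 //.
apply: le_trans hX; rewrite /iid_prob /iid_mean mulr_suml big_mkcond /=.
apply: ler_sum => s _; case: ifPn => hs; first by rewrite ler_wpM2l ?hE.
by rewrite mulr_ge0 ?sqr_ge0.
Qed.

(* Soundness with [M = m], [w = sqrt nu], [t = sqrt alpha], [y = sqrt (delta N)]:
   after division by [N], the variance bound against [delta] times the squared
   distance from the mean to the threshold. *)
Lemma gap_sqr_ge (R : realFieldType) (M w t delta y : R) :
  0 < w -> w ^+ 2 <= 1 / 2 -> 0 < t <= 1 -> 0 < delta < 1 / 2 ->
  9 * w <= M * delta * t ^+ 2 -> 9 <= M * delta * t ->
  0 <= y -> y ^+ 2 = delta * (M * (M - 1) / 2) ->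
  0 < y * t ^+ 2 - w /\
  w ^+ 2 + t ^+ 2 + 2 * M * (w ^+ 2 * t ^+ 2 + t ^+ 3 - t ^+ 4)
    <= (y * t ^+ 2 - w) ^+ 2.
Proof.
move=> w0 w2 /andP[t0 t1] /andP[d0 d2] hw ht y0 y2.
have M18 : 18 <= M.
  have M0 : 0 < M by rewrite -(pmulr_lgt0 _ d0) -(pmulr_lgt0 _ t0); lra.
  have : M * delta * t <= M * delta by rewrite ler_piMr // mulr_ge0 // ltW.
  have : M * delta <= M * (1 / 2) by rewrite ler_wpM2l // ltW.
  lra.
have hK : 9 * t <= M * delta * t ^+ 2.
  by rewrite expr2 mulrA ler_wpM2r // ltW.
set K := M * delta * t ^+ 2 in hw hK.
have D0 : 0 < M * delta by apply: mulr_gt0; lra.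
(* [M >= 18] gives [M - 1 >= 17 / 18 * M]. *)
have y2ge : 17 / 36 * (delta * M ^+ 2) <= y ^+ 2.
  rewrite y2; have : 0 <= delta * M * (M - 18) by rewrite !mulr_ge0 //; lra.
  by nra.
have yge : 17 / 18 * (M * delta) <= y.
  rewrite -(@ler_pXn2r _ 2) ?nnegrE //; last by apply: mulr_ge0; lra.
  apply: le_trans y2ge; have : 0 <= delta * M ^+ 2 * (1 / 2 - delta).
    by rewrite !mulr_ge0 ?sqr_ge0 //; lra.
  by nra.
have t20 : 0 < t ^+ 2 by rewrite exprn_gt0.
have yK : 17 / 18 * K <= y * t ^+ 2.
  by rewrite /K mulrA ler_wpM2r // ltW.
set Z := y * t ^+ 2 in yK *.
(* From [w <= K / 9] and [K <= 18 / 17 * Z], as [2 / 17 <= 1 / 8]. *)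
have hyw : w <= Z / 8 by lra.
split; first lra.
(* All terms are compared with [Q = delta * M ^+ 2 * t ^+ 4]: the squared gap is at least [Q / 3],
   the two parts of the variance at most [Q / 81] and [3 / 10 * Q], and
   [1 / 81 + 3 / 10 <= 1 / 3]. *)
set Q := M * K * t ^+ 2.
have QK : 2 * K ^+ 2 <= Q.
  have -> : Q = (M * t ^+ 2) * K by rewrite /Q; ring.
  have KE : K = delta * (M * t ^+ 2) by rewrite /K; ring.
  have : 0 <= M * t ^+ 2 by rewrite mulr_ge0 //; lra.
  rewrite KE; set z := M * t ^+ 2 => z0.
  have : 0 <= delta * z ^+ 2 * (1 / 2 - delta).
    by rewrite mulr_ge0 ?subr_ge0 ?(ltW d2) // mulr_ge0 ?sqr_ge0 // ltW.
  by nra.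
have hR : Q / 3 <= (Z - w) ^+ 2.
  (* This product is [(Z - w) ^+ 2 - (7 / 8 * Z) ^+ 2]; moreover [49 / 64 * (17 / 36) >= 1 / 3]. *)
  have : 0 <= (Z / 8 - w) * (15 / 8 * Z - w) by rewrite mulr_ge0 //; lra.
  have : 17 / 36 * (delta * M ^+ 2) * (t ^+ 2) ^+ 2 <= y ^+ 2 * (t ^+ 2) ^+ 2.
    by rewrite ler_wpM2r // sqr_ge0.
  have -> : y ^+ 2 * (t ^+ 2) ^+ 2 = Z ^+ 2 by rewrite /Z; ring.
  have -> : 17 / 36 * (delta * M ^+ 2) * (t ^+ 2) ^+ 2 = 17 / 36 * Q.
    by rewrite /Q /K; ring.
  have : 0 <= Q by apply: le_trans QK; rewrite mulr_ge0 ?sqr_ge0.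
  lra.
apply: le_trans hR.
have h1 : w ^+ 2 + t ^+ 2 <= Q / 81.
  have : w ^+ 2 <= (K / 9) ^+ 2 by rewrite ler_pXn2r ?nnegrE //; lra.
  have : t ^+ 2 <= (K / 9) ^+ 2 by rewrite ler_pXn2r ?nnegrE //; lra.
  by rewrite expr_div_n; lra.
have h2 : w ^+ 2 + t - t ^+ 2 <= 3 / 20 * K.
  have [wt|/ltW tw] := leP w t.
    have : w ^+ 2 <= t ^+ 2 by rewrite ler_pXn2r ?nnegrE //; lra.
    lra.
  suff : w ^+ 2 + t - t ^+ 2 <= 27 / 20 * w by lra.
  have [w2l|/ltW w2g] := leP w (1 / 2).
    (* That is, [t - t ^+ 2 <= w - w ^+ 2], so the left-hand side is at most [w]. *)
    have : 0 <= (w - t) * (1 - w - t) by rewrite mulr_ge0 //; lra.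
    lra.
  have w34 : w <= 3 / 4 by rewrite -(@ler_pXn2r _ 2) ?nnegrE //; lra.
  have : 0 <= (w - 1 / 2) * (3 / 4 - w) by rewrite mulr_ge0 //; lra.
  have := sqr_ge0 (t - 1 / 2).
  lra.
have : 2 * (M * t ^+ 2) * (w ^+ 2 + t - t ^+ 2)
    <= 2 * (M * t ^+ 2) * (3 / 20 * K).
  by rewrite ler_wpM2l // !mulr_ge0 // ?ltW //; lra.
have K0 : 0 <= K by lra.
have : 0 <= Q by apply: le_trans QK; rewrite mulr_ge0 ?sqr_ge0.
have -> : 2 * (M * t ^+ 2) * (3 / 20 * K) = 3 / 10 * Q by rewrite /Q; field.
have -> : 2 * M * (w ^+ 2 * t ^+ 2 + t ^+ 3 - t ^+ 4)
  = 2 * (M * t ^+ 2) * (w ^+ 2 + t - t ^+ 2) by ring.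
lra.
Qed.

(** * Lower bounds on the l_2 norm from the l_p norm, by Jensen's inequality *)

(** The concave function [u]^ r[lies below its tangent at]l[. For]0 < r <
    1[this is Young's inequality for](u / l) [^ r] and [1] with exponents [r^-1] and
    [(1 - r)^-1]. *)
Lemma powR_le_tangent (R : realType) (r u l : R) :
  0 <= r <= 1 -> 0 <= u -> 0 < l ->
  u `^ r <= r * (u * l `^ (r - 1)) + (1 - r) * l `^ r.
Proof.
move=> /andP[r0 r1] u0 l0.
have [->|rn0] := eqVneq r 0; first by rewrite !powRr0; lra.
have [->|rn1] := eqVneq r 1; first by rewrite subrr powRr0 powRr1 //; lra.
have r0' : 0 < r by rewrite lt_def rn0.
have r1' : 0 < 1 - r by rewrite subr_gt0 lt_def eq_sym rn1.
have ul0 : 0 <= u / l by rewrite divr_ge0 // ltW.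
have := @conjugate_powR R ((u / l) `^ r) 1 r^-1 (1 - r)^-1 (powR_ge0 _ _) ler01.
rewrite !invr_gt0 !invrK mulr1 powR1 mul1r -powRrM mulfV // powRr1 //.
move=> /(_ r0' r1' (subrKC _ _)) h.
rewrite -{1}(divfK (lt0r_neq0 l0) u) powRM ?(ltW l0) //.
have -> : l `^ (r - 1) = l `^ r / l.
  by rewrite powRB ?powRr1 ?(ltW l0) // (gt_eqF l0) implybT.
rewrite (_ : r * _ + _ = (u / l * r + (1 - r)) * l `^ r); last by ring.
by rewrite ler_wpM2r // powR_ge0.
Qed.

(** Jensen's inequality, by summing tangents at [S / W]. Total weight below [W] is allowed because
    the constant term of the tangent is nonnegative. *)
Lemma sum_powR_le (R : realType) (I : finType) (W r : R) (w u : I -> R) :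
  0 <= r <= 1 -> 0 < W -> (forall i, 0 <= w i) -> (forall i, 0 <= u i) ->
  \sum_i w i <= W -> 0 < \sum_i w i * u i ->
  \sum_i w i * u i `^ r <= W * ((\sum_i w i * u i) / W) `^ r.
Proof.
move=> r01 W0 w0 u0 wW; set S := \sum_i _ => S0.
have l0 : 0 < S / W by rewrite divr_gt0.
have /andP[r0 r1] := r01.
apply: le_trans (ler_sum _ (fun i _ =>
  ler_wpM2l (w0 i) (powR_le_tangent r01 (u0 i) l0))) _.
set l := S / W in l0 *.
rewrite (eq_bigr (fun i => r * l `^ (r - 1) * (w i * u i)
  + (1 - r) * l `^ r * w i)); last by move=> i _; ring.
rewrite big_split /= -!mulr_sumr -/S.
have -> : S = W * l by rewrite /l mulrC divfK // gt_eqF.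
have -> : r * l `^ (r - 1) * (W * l) = r * l `^ r * W.
  have [->|rn0] := eqVneq r 0; first by rewrite !mul0r.
  by rewrite -(@mulr_powRB1 _ l r) ?(ltW l0) 1?lt_def ?rn0 //; ring.
have : (1 - r) * l `^ r * \sum_i w i <= (1 - r) * l `^ r * W.
  by rewrite ler_wpM2l // mulr_ge0 ?powR_ge0 ?subr_ge0.
lra.
Qed.

Section LpBounds.
Context (R : realType) (n : nat) (p eps : R) (V : 'rV[R]_n).
Context (hp : 1 <= p <= 2) (eps0 : 0 < eps) (hV : eps <= lp_norm p V).
Let alpha := \sum_i V 0 i ^+ 2.

Lemma l2_gt0 : 0 < alpha.
Proof.
have p0 : p != 0 by apply/eqP; case/andP: hp; lra.
rewrite lt_def sumr_ge0 ?andbT => [|i _]; last exact: sqr_ge0.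
apply: contraTneq (lt_le_trans eps0 hV) => /eqP.
rewrite psumr_eq0 => [/allP V0|i _]; last exact: sqr_ge0.
rewrite /lp_norm big1 ?powR0 ?ltxx ?invr_eq0 // => i _.
have := V0 i (mem_index_enum _).
by rewrite sqrf_eq0 => /eqP ->; rewrite normr0 powR0.
Qed.

Lemma eps_powR_le : eps `^ p <= \sum_i `|V 0 i| `^ p.
Proof.
have p0 : p != 0 by apply/eqP; case/andP: hp; lra.
have S0 : 0 <= \sum_i `|V 0 i| `^ p by apply: sumr_ge0 => i _; exact: powR_ge0.
rewrite -[leRHS]powRr1 // -(mulVf p0) powRrM ge0_ler_powR ?nnegrE ?powR_ge0 //.
  by case/andP: hp; lra.
exact: ltW.
Qed.

Lemma l2_ge_power_mean : (0 < n)%N ->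
  (eps * n%:R `^ (1 - p^-1)) ^+ 2 <= n%:R * alpha.
Proof.
move=> n0; have [p1 p2] := andP hp.
have p0 : 0 < p by lra.
have n0R : 0 < n%:R :> R by rewrite ltr0n.
have := l2_gt0; rewrite /alpha => a0.
have a0' : 0 < alpha / n%:R by rewrite divr_gt0.
have h : eps `^ p <= n%:R * (alpha / n%:R) `^ (p / 2).
  apply: le_trans eps_powR_le _.
  (* Unit weights, with [|V_i| ^ p] written as [(V_i ^ 2) ^ (p / 2)]. *)
  have := @sum_powR_le R _ n%:R (p / 2) (fun=> 1) (fun i => V 0 i ^+ 2).
  under [\sum_i _ * _ `^ _]eq_bigr => i _.
    rewrite mul1r -real_normK ?num_real // -powR_mulrn // -powRrM mulrC divfK //.
    over.
  under [\sum_i _ * _ ^+ 2]eq_bigr do rewrite mul1r.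
  apply => //; first by apply/andP; split; lra.
    by move=> i; exact: sqr_ge0.
  by rewrite sumr_const card_ord.
have [e0' n0' al0 p0'] : [/\ 0 <= eps, 0 <= n%:R :> R, 0 <= alpha / n%:R
    & 0 <= p].
  by split; apply: ltW.
have {}h : eps <= n%:R `^ p^-1 * (alpha / n%:R) `^ 2^-1.
  have ip0 : 0 <= p^-1 by rewrite invr_ge0.
  have nn0 : 0 <= n%:R * (alpha / n%:R) `^ (p / 2).
    by rewrite mulr_ge0 ?powR_ge0.
  have := @ge0_ler_powR R _ ip0 _ _ (powR_ge0 eps p) nn0 h.
  rewrite -powRrM mulfV ?gt_eqF // powRr1 // powRM ?powR_ge0 //.
  by rewrite -powRrM mulrAC mulfV ?gt_eqF // mul1r.
have {}h : eps * n%:R `^ (1 - p^-1) <= n%:R * (alpha / n%:R) `^ 2^-1.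
  apply: le_trans (ler_wpM2r (powR_ge0 _ _) h) _.
  by rewrite mulrAC -powRD ?(gt_eqF n0R) ?implybT // subrKC powRr1.
move: h; rewrite -(@ler_pXn2r _ 2) ?nnegrE ?mulr_ge0 ?powR_ge0 // => h.
apply: le_trans h _; rewrite exprMn powR12_sqrt // sqr_sqrtr //.
by rewrite expr2 -mulrA [_ * (alpha / _)]mulrC divfK // gt_eqF.
Qed.

Lemma l2_ge_interpolation : 1 < p -> \sum_i `|V 0 i| <= 2 ->
  4 <= alpha * (2 / eps) `^ (p / (p - 1)).
Proof.
move=> p1 V2; have [_ p2] := andP hp.
have a0 := l2_gt0.
have h : eps `^ p <= 2 * (alpha / 2) `^ (p - 1).
  apply: le_trans eps_powR_le _.
  (* Weights [|V_i|] of total at most 2, with [|V_i| ^ p = |V_i| * |V_i| ^ (p - 1)]; the weighted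
     mean then involves [alpha]. *)
  have := @sum_powR_le R _ 2 (p - 1) (fun i => `|V 0 i|) (fun i => `|V 0 i|).
  under [\sum_i _ * _ `^ _]eq_bigr do rewrite mulr_powRB1 ?(lt_trans _ p1) //.
  under [\sum_i _ * `|_|]eq_bigr do rewrite -expr2 real_normK ?num_real //.
  by apply => //; apply/andP; split; lra.
have p10 : 0 < p - 1 by lra.
have {}h : eps `^ (p / (p - 1)) <= 2 `^ (p - 1)^-1 * (alpha / 2).
  have ip0 : 0 <= (p - 1)^-1 by rewrite invr_ge0 ltW.
  have nn0 : 0 <= 2 * (alpha / 2) `^ (p - 1) by rewrite mulr_ge0 ?powR_ge0.
  have := @ge0_ler_powR R _ ip0 _ _ (powR_ge0 eps p) nn0 h.
  rewrite -powRrM powRM ?powR_ge0 // -[_ `^ _ `^ _]powRrM mulfV ?gt_eqF //.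
  by rewrite powRr1 // divr_ge0 // (ltW a0).
have e0' := ltW eps0.
have e0 := powR_gt0 (p / (p - 1)) eps0.
rewrite powRM ?invr_ge0 // -(powR_inv1 e0') powRAC powR_inv1 ?powR_ge0 //.
rewrite mulrA ler_pdivlMr //.
have -> : p / (p - 1) = 1 + (p - 1)^-1 by field; rewrite gt_eqF.
rewrite [2 `^ _]powRD ?pnatr_eq0 ?implybT // powRr1 //.
move: h; have -> : p / (p - 1) = 1 + (p - 1)^-1 by field; rewrite gt_eqF.
lra.
Qed.

End LpBounds.

(** * Completeness and soundness of the collision tester *)

Section Tester.
Context (R : realType) (n m : nat) (delta : R) (hn : (0 < n)%N).
Context (delta0 : 0 < delta).
Let nu := n%:R^-1 : R.

Lemma sum_uniform : \sum_(i < n) nu = 1.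
Proof.
by rewrite sumr_const card_ord -[LHS]mulr_natl mulfV // pnatr_eq0 -lt0n.
Qed.

Lemma uniform_mass_gt0 : 0 < nu.
Proof. by rewrite invr_gt0 ltr0n. Qed.

Lemma uniform_distP : is_distribution (uniform_dist R n).
Proof.
split=> [i|]; first by rewrite mxE ltW ?uniform_mass_gt0.
by under eq_bigr do rewrite mxE; exact: sum_uniform.
Qed.

Lemma collision_tester_complete :
  1 - delta <= iid_prob (uniform_dist R n)
    (fun s : {ffun 'I_m -> 'I_n} => is_Uniform (collision_tester delta s)).
Proof.
have UE (s : {ffun 'I_m -> 'I_n}) : is_Uniform (collision_tester delta s)
    = ((collisions s)%:R <= collision_threshold n m delta).
  by rewrite /collision_tester; case: ifP.
(* With at most one sample there are no pairs: the gap would be 0 and Chebyshev's inequality says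
   nothing, but the tester always accepts. *)
have [m1|m2] := leqP m 1.
  rewrite /iid_prob (eq_bigl xpredT) => [|s]; last first.
    rewrite UE /collision_threshold bin_small // mul0r add0r.
    rewrite (_ : collisions s = 0%N) ?sqrtr_ge0 // /collisions.
    rewrite big1 // => j _; rewrite big1 // => k jk.
    by have := ltn_ord k; have := ltn_ord j; lia.
  by rewrite (sum_iid_weight m uniform_distP.2) lerBlDr lerDl ltW.
have N0 : 0 < 'C(m, 2)%:R :> R by rewrite ltr0n bin_gt0.
have := uniform_mass_gt0 => nu0; set N := 'C(m, 2)%:R in N0 *.
have arg0 : 0 < N * nu / delta by rewrite divr_gt0 // mulr_gt0.
have TE : collision_threshold n m delta = N * nu + Num.sqrt (N * nu / delta).
  by rewrite /collision_threshold !div1r -/nu -/N; congr (_ + Num.sqrt _); ring.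
set gap := Num.sqrt _ in TE.
have gap2 : gap ^+ 2 = N * nu / delta by rewrite sqr_sqrtr // ltW.
apply: (@iid_prob_chebyshev _ _ _ _ _ (fun s => (collisions s)%:R)
  (N * nu) gap _ uniform_distP).
- by rewrite sqrtr_gt0.
- move=> s; rewrite UE -ltNge TE => h.
  have g0 : 0 <= gap by exact: sqrtr_ge0.
  by rewrite ler_pXn2r ?nnegrE //; lra.
have bE : \sum_i uniform_dist R n 0 i ^+ 2 = nu.
  under eq_bigr do rewrite mxE -/nu expr2.
  by rewrite -mulr_sumr sum_uniform mulr1.
have cE : \sum_i uniform_dist R n 0 i ^+ 3 = nu ^+ 2.
  under eq_bigr do rewrite mxE -/nu exprSr.
  by rewrite -mulr_sumr sum_uniform mulr1.
have := collision_variance m uniform_distP.2; rewrite bE cE => ->.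
(* The threshold slack is such that [delta * gap ^+ 2 = N * nu], while the variance is
   [N * (nu - nu ^+ 2)]. *)
rewrite gap2 [delta * _]mulrC divfK ?gt_eqF // ler_wpM2l ?(ltW N0) //.
by have := sqr_ge0 nu; lra.
Qed.

Section Far.
Context (A : 'rV[R]_n) (hA : is_distribution A).
Let V := A - uniform_dist R n.
Let alpha := \sum_i V 0 i ^+ 2.
Let t := Num.sqrt alpha.
Let w := Num.sqrt nu.

Lemma deviationE i : A 0 i = V 0 i + nu.
Proof. by rewrite /V !mxE subrK. Qed.

Lemma sum_deviation : \sum_i V 0 i = 0.
Proof.
have : \sum_i (V 0 i + nu) = 1
  by rewrite -hA.2; apply: eq_bigr => i _; rewrite deviationE.
by rewrite big_split /= sum_uniform; lra.
Qed.

Lemma sum_norm_deviation : \sum_i `|V 0 i| <= 2.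
Proof.
have [A0 A1] := hA.
have -> : 2 = \sum_i (A 0 i + nu) by rewrite big_split /= A1 sum_uniform; lra.
apply: ler_sum => i _; have -> : V 0 i = A 0 i - nu by rewrite deviationE addrK.
by rewrite (le_trans (ler_normB _ _)) // !ger0_norm // ltW ?uniform_mass_gt0.
Qed.

Lemma sum_sqrE : \sum_i A 0 i ^+ 2 = nu + alpha.
Proof.
rewrite (eq_bigr (fun i => V 0 i ^+ 2 + (2 * nu * V 0 i + nu * nu))).
  by rewrite !big_split /= -!mulr_sumr sum_deviation sum_uniform -/alpha; ring.
by move=> i _; rewrite deviationE; ring.
Qed.

Lemma sum_cubeE :
  \sum_i A 0 i ^+ 3 = \sum_i V 0 i ^+ 3 + 3 * nu * alpha + nu ^+ 2.
Proof.
rewrite (eq_bigr (fun i => V 0 i ^+ 3 + 3 * nu * V 0 i ^+ 2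
  + (3 * nu ^+ 2 * V 0 i + nu ^+ 2 * nu))).
  by rewrite !big_split /= -!mulr_sumr sum_deviation sum_uniform -/alpha; ring.
by move=> i _; rewrite deviationE; ring.
Qed.

Lemma l2_deviation_le1 : alpha <= 1.
Proof.
have [A0 A1] := hA; have := uniform_mass_gt0.
suff : \sum_i A 0 i ^+ 2 <= 1 by rewrite sum_sqrE; lra.
rewrite -A1; apply: ler_sum => i _; rewrite expr2 ler_piMr // -A1.
by rewrite (bigD1 i) //= lerDl sumr_ge0.
Qed.

(** Each [|V_i|] is at most the l_2 norm [t]. *)
Lemma sum_deviation_cube_le : \sum_i V 0 i ^+ 3 <= alpha * t.
Proof.
rewrite mulr_suml; apply: ler_sum => i _; rewrite exprSr.
rewrite ler_wpM2l ?sqr_ge0 // (le_trans (ler_norm _)) // -sqrtr_sqr.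
rewrite ler_wsqrtr // /alpha (bigD1 i) //= lerDl.
by apply: sumr_ge0 => j _; exact: sqr_ge0.
Qed.

(** The difference is the variance of [A 0 x] for [x] drawn from [A]. *)
Lemma sqr_sum_sqr_le_sum_cube :
  (\sum_i A 0 i ^+ 2) ^+ 2 <= \sum_i A 0 i ^+ 3.
Proof.
rewrite -subr_ge0; have [A0 A1] := hA; set b := \sum_i A 0 i ^+ 2.
suff -> : \sum_i A 0 i ^+ 3 - b ^+ 2 = \sum_i A 0 i * (A 0 i - b) ^+ 2.
  by apply: sumr_ge0 => i _; rewrite mulr_ge0 ?sqr_ge0.
rewrite [RHS](eq_bigr (fun i => A 0 i ^+ 3 - 2 * b * A 0 i ^+ 2
  + b ^+ 2 * A 0 i)); last by move=> i _; ring.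
by rewrite big_split sumrB /= -!mulr_sumr A1 -/b; ring.
Qed.

Lemma collision_tester_sound :
  (2 <= n)%N -> delta < 1 / 2 -> 0 < alpha ->
  9 * w <= m%:R * delta * t ^+ 2 -> 9 <= m%:R * delta * t ->
  1 - delta <= iid_prob A
    (fun s : {ffun 'I_m -> 'I_n} => is_NotUniform (collision_tester delta s)).
Proof.
move=> n2 delta2 a0 hw ht.
have NE (s : {ffun 'I_m -> 'I_n}) : is_NotUniform (collision_tester delta s)
    = ~~ ((collisions s)%:R <= collision_threshold n m delta).
  by rewrite /collision_tester; case: ifP.
have nu0 := uniform_mass_gt0.
have t2 : t ^+ 2 = alpha by rewrite sqr_sqrtr // ltW.
have w2 : w ^+ 2 = nu by rewrite sqr_sqrtr // ltW.
have t0 : 0 < t by rewrite sqrtr_gt0.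
have w0 : 0 < w by rewrite sqrtr_gt0.
have t1 : t <= 1 by rewrite -sqrtr1 ler_wsqrtr // l2_deviation_le1.
have nu2 : nu <= 1 / 2.
  by rewrite div1r /nu lef_pV2 ?posrE ?ltr0n // ler_nat.
set M := m%:R in hw ht.
have NM : 'C(m, 2)%:R = M * (M - 1) / 2 :> R.
  have [m0|m0] := posnP m; first by rewrite /M m0 bin0n !mul0r.
  have : (m%:R * m.-1%:R)%R = 2 * 'C(m, 2)%:R :> R.
    by rewrite -!natrM -(mul_bin_diag m 1) bin1.
  by rewrite -subn1 natrB // -/M => ->; field.
have M1 : 1 < M.
  have M0 : 0 < M by rewrite -(pmulr_lgt0 _ delta0) -(pmulr_lgt0 _ t0); lra.
  have : M * delta * t <= M * delta by rewrite ler_piMr // mulr_ge0 // ltW.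
  have : M * delta <= M * (1 / 2) by rewrite ler_wpM2l // ltW.
  lra.
set N := 'C(m, 2)%:R in NM *.
have N0 : 0 < N by rewrite NM divr_gt0 // mulr_gt0 //; lra.
pose y := Num.sqrt (delta * N).
have y2 : y ^+ 2 = delta * N by rewrite sqr_sqrtr // mulr_ge0 // ltW.
have y0 : 0 < y by rewrite sqrtr_gt0 mulr_gt0.
have [] := @gap_sqr_ge R M w t delta y w0 _ _ _ hw ht (ltW y0) _.
- by rewrite w2.
- by rewrite t0.
- by rewrite delta0.
- by rewrite y2 NM.
move=> gap0 gap2.
(* Chosen so that [r * y = N] and [r * w] is the threshold slack; mean minus threshold is then
   [r * (y * t ^+ 2 - w)]. *)
pose r := y / delta.
have r0 : 0 < r by rewrite divr_gt0.
have ry : r * y = N by rewrite /r mulrAC -expr2 y2 mulrAC mulfV ?mul1r ?gt_eqF.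
have TE : collision_threshold n m delta = N * nu + r * w.
  rewrite /collision_threshold -/N div1r -/nu; congr (_ + _).
  have -> : 1 / delta * N * nu = (r * w) ^+ 2.
    rewrite exprMn w2 /r expr_div_n y2; field; rewrite ?gt_eqF //.
  by rewrite sqrtr_sqr ger0_norm // mulr_ge0 // ltW.
apply: (@iid_prob_chebyshev _ _ _ _ _ (fun s => (collisions s)%:R)
  (N * (nu + alpha)) (r * (y * t ^+ 2 - w)) _ hA).
- exact: mulr_gt0.
- move=> s; rewrite NE negbK TE => h.
  have g0 := mulr_gt0 r0 gap0.
  have gle : r * (y * t ^+ 2 - w) <= - ((collisions s)%:R - N * (nu + alpha)).
    by rewrite mulrBr mulrA ry t2; lra.
  rewrite -[leRHS]sqrrN ler_pXn2r ?nnegrE ?(ltW g0) //.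
  exact: le_trans (ltW g0) gle.
have := collision_variance m hA.2; rewrite sum_sqrE -/N => ->.
have -> : delta * (r * (y * t ^+ 2 - w)) ^+ 2 = N * (y * t ^+ 2 - w) ^+ 2.
  rewrite -ry /r; field; rewrite gt_eqF //.
rewrite ler_wpM2l ?(ltW N0) //; apply: le_trans gap2.
have := sqr_sum_sqr_le_sum_cube; rewrite -subr_ge0 sum_sqrE.
set v := _ - _ ^+ 2 => v0.
have c0 : 0 <= \sum_i A 0 i ^+ 3.
  by apply: sumr_ge0 => i _; rewrite exprn_ge0 //; have [] := hA.
have vle : v <= w ^+ 2 * t ^+ 2 + t ^+ 3 - t ^+ 4.
  have := sum_deviation_cube_le; rewrite /v sum_cubeE w2 -t2 => h.
  have -> : t ^+ 3 = t ^+ 2 * t by ring.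
  have -> : t ^+ 4 = (t ^+ 2) ^+ 2 by ring.
  by lra.
have m1M : m.-1%:R <= M by rewrite ler_nat leq_pred.
(* Nonnegativity of [v] permits enlarging both factors. The remaining variance term is
   [b - c - v <= b = w ^+ 2 + t ^+ 2], with [b] and [c] the sums of squares and cubes. *)
have : 2 * m.-1%:R * v <= 2 * M * (w ^+ 2 * t ^+ 2 + t ^+ 3 - t ^+ 4).
  by rewrite ler_pM ?mulr_ge0 // ler_pM2l.
rewrite /v w2 t2 in v0 *; lra.
Qed.

End Far.
End Tester.

(** * Hölder conjugates and the prescribed sample size *)

(** Inverting in the extended reals covers [p = 1] too, where the conjugate is infinite with inverse
    0. *)
Lemma fine_inv_hoelder_conjugate (R : realType) (p : R) : 1 <= p ->
  fine (hoelder_conjugate p%:E)^-1%E = 1 - p^-1.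
Proof.
move=> p1; have p0 : p != 0 by rewrite gt_eqF // (lt_le_trans ltr01).
have := @hoelder_conjugate_eq1 R p%:E (ltNyr p).
rewrite eqe => /(_ p0); rewrite inver (negbTE p0) => pq.
have : fine ((p^-1)%:E + (hoelder_conjugate p%:E)^-1) = 1 by rewrite pq.
case: (_^-1)%E pq => [z _ /= <-|//|//]; by rewrite addrC addrK.
Qed.

Lemma hoelder_conjugate_gt1 (R : realType) (p : R) : 1 < p ->
  hoelder_conjugate p%:E = (p / (p - 1))%:E.
Proof.
move=> p1; rewrite /hoelder_conjugate /= eqe gt_eqF ?(lt_trans ltr01) //.
by rewrite -EFinD inver subr_eq0 gt_eqF.
Qed.

Theorem theorem1 (R : realType) (p eps delta : R) (n m : nat)
    (hp : 1 <= p <= 2) (hn : (2 <= n)%N)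
    (heps : 0 < eps < 1) (hdelta : 0 < delta < 1 / 2)
    (hm : prescribed_samples n (hoelder_conjugate p%:E) eps delta m) :
  solves_uniformity_testing p eps delta
    (@collision_tester R n m delta).
Proof.
have [[[p1 p2] [e0 e1]] [d0 d2]] := (andP hp, andP heps, andP hdelta).
have n0 : (0 < n)%N by apply: ltnW.
split=> [|A hA hdist]; first exact: collision_tester_complete.
have := l2_gt0 hp e0 hdist; have := l2_ge_power_mean hp e0 hdist n0.
have := l2_ge_interpolation hp e0 hdist.
set alpha := \sum_i _ ^+ 2; set s := eps * _ => hlarge hsmall a0.
have nR0 : 0 < n%:R :> R by rewrite ltr0n.
have s0 : 0 < s by rewrite mulr_gt0 // powR_gt0.
have ge_ceil (x : R) : m%:Z = Num.ceil x -> x <= m%:R.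
  by move=> mE; rewrite -[m%:R]/(m%:Z%:~R) mE ceil_ge.
pose t := Num.sqrt alpha; pose w := Num.sqrt n%:R^-1 : R.
have t2 : t ^+ 2 = alpha by rewrite sqr_sqrtr // ltW.
have t0 : 0 < t by rewrite sqrtr_gt0.
have w0 : 0 < w by rewrite sqrtr_gt0 invr_gt0.
have w2 : w ^+ 2 = n%:R^-1 by rewrite sqr_sqrtr // invr_ge0 ltW.
have wn : w * Num.sqrt n%:R = 1.
  by rewrite -sqrtrM ?invr_ge0 ?(ltW nR0) // mulVf ?sqrtr1 // gt_eqF.
have sw0 := mulr_ge0 (ltW s0) (ltW w0).
have stw : s * w <= t.
  rewrite -(@ler_pXn2r _ 2) ?nnegrE ?(ltW t0) //.
  by rewrite exprMn w2 t2 ler_pdivrMr // mulrC.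
(* Thus comparing [n] with [1 / eps ^ q] amounts to comparing [s] with 1. *)
have sq : 1 < p -> s `^ (p / (p - 1)) = eps `^ (p / (p - 1)) * n%:R.
  move=> p1'; rewrite /s powRM ?powR_ge0 ?(ltW e0) // -powRrM.
  have -> : (1 - p^-1) * (p / (p - 1)) = 1 by field; rewrite !gt_eqF //; lra.
  by rewrite powRr1 // ltW.
suff [hw ht] : 9 * w <= m%:R * delta * t ^+ 2 /\ 9 <= m%:R * delta * t.
  exact: (collision_tester_sound n0 d0 hA hn d2 a0 hw ht).
case: hm => -[hnq /ge_ceil hm].
  have s1 : s <= 1.
    move: p1; rewrite le_eqVlt => /orP[/eqP p1|p1].
      by rewrite /s -p1 invr1 subrr powRr0 mulr1 ltW.
    move: hnq; rewrite hoelder_conjugate_gt1 //= lee_fin.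
    rewrite ler_pdivlMr ?powR_gt0 // mulrC -sq // => hnq.
    rewrite leNgt; apply/negP => s1.
    have q0 : 0 < p / (p - 1) by rewrite divr_gt0 ?subr_gt0 // (lt_trans ltr01).
    have := gt0_ltr_powR q0 ler01 (ltW s0) s1.
    by rewrite powR1 ltNge hnq.
  (* The sample size gives [m * delta * s ^+ 2 >= 9 * sqrt n], and [w] is the inverse of
     [sqrt n]. *)
  have hMs : 9 <= m%:R * delta * s ^+ 2 * w.
    move: hm; rewrite /samples_small /root_pow.
    rewrite fine_inv_hoelder_conjugate // -/s => hm.
    have sq0 : 0 < s ^+ 2 by rewrite exprn_gt0.
    have E : 9 / delta * (Num.sqrt n%:R / s ^+ 2) * (delta * s ^+ 2 * w)
        = 9 * (w * Num.sqrt n%:R) by field; rewrite !gt_eqF.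
    rewrite -[leLHS]mulr1 -[X in _ * X]wn -E.
    rewrite -[leRHS](_ : m%:R * (delta * s ^+ 2 * w) = _); last by ring.
    by rewrite ler_wpM2r // !mulr_ge0 // ltW.
  have Md : 0 <= m%:R * delta by rewrite mulr_ge0 // ltW.
  have sst : s ^+ 2 * w <= t.
    apply: le_trans stw; rewrite ler_wpM2r ?(ltW w0) // expr2 ler_piMr //.
    exact: ltW.
  split; last by apply: le_trans hMs _; rewrite -mulrA ler_wpM2l.
  apply: le_trans (ler_wpM2r (ltW w0) hMs) _.
  have -> : m%:R * delta * s ^+ 2 * w * w = m%:R * delta * (s * w) ^+ 2 by ring.
  by rewrite ler_wpM2l // ler_pXn2r ?nnegrE // ltW.
(* At [p = 1] the bound [1 / eps ^ q] is infinite, so [n] cannot reach it. *)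
have pgt1 : 1 < p.
  rewrite lt_def p1 andbT; apply: contraTneq hnq => ->.
  by rewrite hoelder_conjugate1.
have s1 : 1 <= s.
  move: hnq; rewrite hoelder_conjugate_gt1 //= lee_fin.
  rewrite ler_pdivrMr ?powR_gt0 // mulrC -sq // => hnq.
  rewrite leNgt; apply/negP => s1.
  have q0 : 0 < p / (p - 1) by rewrite divr_gt0 ?subr_gt0 // (lt_trans ltr01).
  have := gt0_ltr_powR q0 (ltW s0) ler01 s1.
  by rewrite powR1 ltNge hnq.
have wt : w <= t.
  by apply: le_trans stw; rewrite ler_peMl // ltW.
move: hm; rewrite /samples_large hoelder_conjugate_gt1 //=.
set z := Num.sqrt _ => hm.
(* Square root of the interpolation bound; the factor 2 cancels the [1 / 2] in the sample size. *)
have tz : 2 <= t * z.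
  have h4 := hlarge pgt1 (sum_norm_deviation n0 hA).
  rewrite /t /z -sqrtrM ?(ltW a0) //.
  rewrite -[leLHS](_ : Num.sqrt 4 = 2) ?ler_wsqrtr //.
  by have -> : 4 = 2 ^+ 2 :> R; [ring | rewrite sqrtr_sqr ger0_norm].
have ht : 9 <= m%:R * delta * t.
  have : 9 / delta * (1 / 2 * z) * (delta * t) <= m%:R * (delta * t).
    by rewrite ler_wpM2r // mulr_ge0 // ltW.
  have -> : 9 / delta * (1 / 2 * z) * (delta * t) = 9 / 2 * (t * z).
    by field; rewrite gt_eqF.
  by rewrite -[m%:R * delta * t]mulrA; apply: le_trans; lra.
(* Multiply [9 <= m * delta * t] by [w <= t]. *)
split=> //; rewrite expr2 mulrA.
by rewrite ler_pM // ltW.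
Qed.
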